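(* Let $\alpha\in(0,1)$, $\kappa>0$, $T>0$, $N\in\mathbb{N}$, $\tau=T/N$, and let $\Omega\subset\mathbb{R}^d$, $d\in\{1,2,3\}$, be a bounded smooth domain. Given $u_0$, let $u_1,\dots,u_N$ be the solution of the convex splitting (CS) scheme $$\bar\partial_\tau^\alpha u_n-\kappa^2\Delta u_n=u_{n-1}-(u_n)^3\ \text{ in }\Omega,\qquad u_n=0\ \text{ on }\partial\Omega,\qquad 1\le n\le N.$$ Then the scheme satisfies the discrete maximum principle unconditionally (i.e. for every step size $\tau$): if $\|u_0\|_{L^\infty(\Omega)}\le1$, then $\|u_n\|_{L^\infty(\Omega)}\le1$ for all $n\ge1$.
   Context: The backward Euler convolution quadrature is $\bar\partial_\tau^\alpha u_n=\tau^{-\alpha}\sum_{j=1}^n\omega_{n-j}(u_j-u_0)$, with $\omega_0=1$ and $\omega_j=(-1)^j\frac{\alpha(\alpha-1)\cdots(\alpha-j+1)}{j!}$ for $j\ge1$. The scheme is discrete in time and continuous in space; at each step it is a uniquely solvable nonlinear elliptic problem for $u_n\in H_0^1(\Omega)$, given $u_0,\dots,u_{n-1}$. *)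

(* Defs.v *)
From HB Require Import structures.
From mathcomp Require Import all_boot all_order all_algebra.
From mathcomp Require Import all_classical all_reals all_analysis.

Set Implicit Arguments.
Unset Strict Implicit.
Unset Printing Implicit Defensive.

Import Order.TTheory GRing.Theory Num.Theory.
Import numFieldNormedType.Exports.

Local Open Scope classical_set_scope.
Local Open Scope ring_scope.

(* R^d is 'rV[R]_d. Its sigma-algebra is generated by the coordinate maps
   (the product sigma-algebra, i.e. the Borel one), as the library does for
   n.-tuple T. *)
Definition rV_display : measure_display.
Proof. exact. Qed.

Section measurable_rV.
Context {R : realType} (d : nat).

Let coor (i : 'I_d) (x : 'rV[R]_d) : measurableTypeR R := x ord0 i.

Let rV_set0 : g_sigma_preimage coor set0.
Proof. exact: sigma_algebra0. Qed.

Let rV_setC A : g_sigma_preimage coor A -> g_sigma_preimage coor (~` A).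
Proof. exact: sigma_algebraC. Qed.

Let rV_bigcup (F : (set 'rV[R]_d)^nat) :
  (forall i, g_sigma_preimage coor (F i)) ->
  g_sigma_preimage coor (\bigcup_i (F i)).
Proof. exact: sigma_algebra_bigcup. Qed.

HB.instance Definition _ := @isMeasurable.Build rV_display 'rV[R]_d
  (g_sigma_preimage coor) rV_set0 rV_setC rV_bigcup.

End measurable_rV.

Section measurable_rV_lemmas.
Context {R : realType}.

Lemma measurable_fun_rVP d' (T : measurableType d') d (f : T -> 'rV[R]_d) :
  measurable_fun [set: T] f <->
  forall i, measurable_fun [set: T] (fun x => f x ord0 i : measurableTypeR R).
Proof.
pose c (i : 'I_d) (x : 'rV[R]_d) : measurableTypeR R := x ord0 i.
apply: (@iff_trans _ (g_sigma_preimage (fun i => c i \o f) `<=` measurable)).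
  rewrite g_sigma_preimage_comp; split=> [mf A [/= C preC <-]|prefS].
    exact: mf.
  by move=> _ A mA; apply: prefS; exists A.
split=> [fS i|mf].
- move=> _ A mA; apply: fS; apply: sub_sigma_algebra.
  case: d i @c f => [[] []//|d i c f].
  rewrite -bigcup_mkord_ord; exists i; first exact: ltn_ord.
  by exists A => //; rewrite inord_val.
- apply: smallest_sub; first exact: sigma_algebra_measurable.
  case: d @c f mf => [|d] c f mf; first by rewrite big_ord0.
  rewrite -bigcup_mkord_ord; apply: bigcup_sub => i Ii.
  by move=> A [B mB <-]; exact: mf.
Qed.

Lemma measurable_coord d (i : 'I_d) :
  measurable_fun [set: 'rV[R]_d]
    (fun x : 'rV[R]_d => x ord0 i : measurableTypeR R).
Proof. by apply: (measurable_fun_rVP id).1; exact: measurable_id. Qed.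

Definition rV_cons d (p : measurableTypeR R * 'rV[R]_d) : 'rV[R]_d.+1 :=
  \row_(i < d.+1) if unlift ord0 i is Some j then p.2 ord0 j else p.1.

Definition rV_uncons d (x : 'rV[R]_d.+1) : measurableTypeR R * 'rV[R]_d :=
  (x ord0 ord0, \row_(j < d) x ord0 (lift ord0 j)).

Lemma rV_consK d : cancel (@rV_cons d) (@rV_uncons d).
Proof.
move=> [a y]; rewrite /rV_uncons /rV_cons mxE unlift_none; congr pair.
by apply/rowP => j; rewrite !mxE liftK.
Qed.

Lemma rV_unconsK d : cancel (@rV_uncons d) (@rV_cons d).
Proof.
by move=> x; apply/rowP => i; rewrite !mxE; case: unliftP => [j|] ->; rewrite ?mxE.
Qed.

Lemma measurable_rV_cons d : measurable_fun setT (@rV_cons d).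
Proof.
apply/measurable_fun_rVP => i.
rewrite (_ : (fun _ => _) = fun p : measurableTypeR R * 'rV[R]_d =>
  if unlift ord0 i is Some j then p.2 ord0 j else p.1 : measurableTypeR R);
  last by apply/funext => p; rewrite mxE.
case: (unlift ord0 i) => [j|]; last exact: measurable_fst.
exact: measurableT_comp (measurable_coord j) measurable_snd.
Qed.

Lemma measurable_rV_uncons d : measurable_fun setT (@rV_uncons d).
Proof.
apply/measurable_fun_pairP; split; first exact: measurable_coord.
apply/measurable_fun_rVP => j /=.
rewrite (_ : (fun _ => _) = fun x : 'rV[R]_d.+1 => x ord0 (lift ord0 j));
  last by apply/funext => x; rewrite mxE.
exact: measurable_coord.
Qed.

End measurable_rV_lemmas.

Section lebesgue_rV_step.
Context {R : realType} (d : nat).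
Variable nu : {sigma_finite_measure set 'rV[R]_d -> \bar R}.

Local Notation prod := (product_measure1 (@lebesgue_measure R) nu).

Definition lebesgue_rV_step : set 'rV[R]_d.+1 -> \bar R :=
  pushforward prod (@rV_cons R d).

Let step0 : lebesgue_rV_step set0 = 0%E.
Proof. by rewrite /lebesgue_rV_step /pushforward preimage_set0 measure0. Qed.

Let step_ge0 A : (0 <= lebesgue_rV_step A)%E.
Proof. exact: (@measure_ge0 _ _ _ prod). Qed.

Let step_sigma_additive : semi_sigma_additive lebesgue_rV_step.
Proof.
exact: (@measure_semi_sigma_additive _ _ _
  (measure_function_pushforward__canonical__measure_function_Measure
     prod (@measurable_rV_cons R d))).
Qed.

HB.instance Definition _ := isMeasure.Build _ _ _ lebesgue_rV_step
  step0 step_ge0 step_sigma_additive.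

Let step_sigma_finite : sigma_finite setT lebesgue_rV_step.
Proof.
have /sigma_finiteP[F [FT ndF Foo]] := sigma_finiteT (@lebesgue_measure R).
have /sigma_finiteP[G [GT ndG Goo]] := sigma_finiteT nu.
exists (fun k => @rV_uncons R d @^-1` (F k `*` G k)).
  rewrite -preimage_bigcup (_ : \bigcup_k _ = setT) ?preimage_setT//.
  rewrite -subTset => -[x y] _.
  have [i _ Fix] : (\bigcup_i F i) x by rewrite -FT.
  have [j _ Gjy] : (\bigcup_j G j) y by rewrite -GT.
  exists (maxn i j) => //; split.
    exact: (subsetPset _ _ (ndF _ _ (leq_maxl i j)) _ Fix).
  exact: (subsetPset _ _ (ndG _ _ (leq_maxr i j)) _ Gjy).
move=> k; have [mF Fkoo] := Foo k; have [mG Gkoo] := Goo k; split.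
  rewrite -[X in measurable X]setTI; apply: measurable_rV_uncons => //.
  exact: measurableX.
rewrite /lebesgue_rV_step /pushforward -comp_preimage.
rewrite (_ : _ \o _ = id) ?preimage_id; last by apply/funext; exact: rV_consK.
by rewrite product_measure1E// lte_mul_pinfty// ge0_fin_numE.
Qed.

HB.instance Definition _ := Measure_isSigmaFinite.Build _ _ _ lebesgue_rV_step
  step_sigma_finite.

End lebesgue_rV_step.

(* d-dimensional Lebesgue measure, as the d-fold product of the
   one-dimensional one. *)
Fixpoint lebesgue_rV (R : realType) (d : nat) :
    {sigma_finite_measure set 'rV[R]_d -> \bar R} :=
  match d with
  | 0 => dirac (0 : 'rV[R]_0)
  | d'.+1 => lebesgue_rV_step (lebesgue_rV R d')
  end.

Lemma lebesgue_rV_box (R : realType) (d : nat)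
    (A : 'I_d -> set (measurableTypeR R)) : (forall i, measurable (A i)) ->
  lebesgue_rV R d [set x | forall i, A i (x ord0 i)] =
  (\prod_(i < d) lebesgue_measure (A i))%E.
Proof.
elim: d A => [|d IH] A mA.
  by rewrite big_ord0 /= diracE mem_set// => -[].
rewrite big_ord_recl -IH//= /lebesgue_rV_step /pushforward.
have mB : measurable [set x : 'rV[R]_d | forall i, A (lift ord0 i) (x ord0 i)].
  rewrite (_ : mkset _ = \big[setI/setT]_(i < d)
      [set x : 'rV[R]_d | A (lift ord0 i) (x ord0 i)]).
    apply: big_ind => // [|i _]; first exact: measurableI.
    by rewrite -[X in measurable X]setTI; exact: measurable_coord.
  rewrite -bigcap_seq; apply/seteqP; split=> x /= H i => [_|]; first exact: H.
  by apply: H; rewrite /= mem_index_enum.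
rewrite -product_measure1E//.
congr product_measure1; apply/seteqP; split=> -[a y] /=.
  move=> H; split; first by have := H ord0; rewrite mxE unlift_none.
  by move=> i; have := H (lift ord0 i); rewrite mxE liftK.
by move=> [Aa Ay] i; rewrite mxE; case: unliftP => [j|] ->//; exact: Ay.
Qed.

Section sobolev.
Context {R : realType} {d : nat}.
Local Notation mu := (lebesgue_rV R d).
Implicit Types (Omega : set 'rV[R]_d) (f u v : 'rV[R]_d -> R).
Implicit Types (g h : 'I_d -> 'rV[R]_d -> R) (i : 'I_d).

Definition partial i f : 'rV[R]_d -> R := 'D_(delta_mx ord0 i) f.

(* f is C^oo on R^d: all iterated partial derivatives exist and are
   continuous. *)
Definition smooth f := forall s : seq 'I_d, let fs := foldr partial f s in
  (forall i x, derivable fs x (delta_mx ord0 i)) /\ continuous fs.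

(* C_c^oo(Omega) *)
Definition test_function Omega f :=
  [/\ smooth f, compact (closure [set x | f x != 0]) &
      closure [set x | f x != 0] `<=` Omega].

(* Near each boundary point p, Omega is the side {rho < 0} of a smooth
   hypersurface {rho = 0} on which d rho does not vanish at p. *)
Definition smooth_boundary Omega :=
  forall p, (closure Omega `&` closure (~` Omega)) p ->
  exists (U : set 'rV[R]_d) (rho : 'rV[R]_d -> R),
    [/\ open U, U p, smooth rho, (exists i, partial i rho p != 0) &
        Omega `&` U = [set x | rho x < 0] `&` U].

Definition bounded_smooth_domain Omega :=
  [/\ Omega !=set0, open Omega, connected Omega, bounded_set Omega &
      smooth_boundary Omega].

(* The L^p(Omega) norm, computed on the extension by zero. *)
Definition Lp_norm (p : \bar R) Omega f : \bar R :=
  'N[mu]_p[EFin \o (f \_ Omega)]%E.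

Definition in_L2 Omega f := f \_ Omega \in Lfun mu 2%:E.

Definition is_weak_gradient Omega u g :=
  forall i phi, test_function Omega phi ->
  (\int[mu]_(x in Omega) (u x * partial i phi x)%:E =
   - \int[mu]_(x in Omega) (g i x * phi x)%:E)%E.

(* u is in H^1(Omega), with weak gradient g. *)
Definition in_H1 Omega u g :=
  [/\ in_L2 Omega u, forall i, in_L2 Omega (g i) & is_weak_gradient Omega u g].

(* u is in H^1_0(Omega), the H^1-closure of C_c^oo(Omega), with weak
   gradient g. *)
Definition in_H10 Omega u g :=
  in_H1 Omega u g /\
  exists phi : nat -> 'rV[R]_d -> R,
    [/\ forall k, test_function Omega (phi k),
        Lp_norm 2%:E Omega (phi k \- u) @[k --> \oo] --> 0%E &
        forall i, Lp_norm 2%:E Omega (partial i (phi k) \- g i)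
                  @[k --> \oo] --> 0%E].

Definition cq_weight (alpha : R) (j : nat) : R :=
  (-1) ^+ j * (\prod_(i < j) (alpha - i%:R)) / (j`!)%:R.

Definition backward_euler_cq (alpha tau : R) (u : nat -> 'rV[R]_d -> R) (n : nat)
    : 'rV[R]_d -> R := fun x =>
  tau `^ (- alpha) *
  \sum_(1 <= j < n.+1) cq_weight alpha (n - j) * (u j x - u 0%N x).

(* Weak form of  w - kappa^2 Delta u = f in Omega, u = 0 on the boundary:
   u is in H^1_0(Omega) and
     (w, v) + kappa^2 (grad u, grad v) = (f, v)  for all v in H^1_0(Omega).
   The integrals are extended-real valued: when w is in L^2(Omega) the left-hand
   side is finite, so the identity forces (f, v) to be finite, and no separate
   integrability condition on f v is needed. *)
Definition weak_dirichlet (kappa : R) Omega (w u f : 'rV[R]_d -> R) :=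
  exists g, in_H10 Omega u g /\
  forall v h, in_H10 Omega v h ->
  (\int[mu]_(x in Omega)
      (w x * v x + kappa ^+ 2 * \sum_(i < d) g i x * h i x)%:E =
   \int[mu]_(x in Omega) (f x * v x)%:E)%E.

Definition cs_scheme (alpha kappa tau : R) (N : nat) Omega
    (u : nat -> 'rV[R]_d -> R) :=
  forall n, (1 <= n <= N)%N ->
  weak_dirichlet kappa Omega (backward_euler_cq alpha tau u n) (u n)
    (fun x => u n.-1 x - u n x ^+ 3).

End sobolev.

(* Main.v *)
(** Let G be odd, C^oo and nondecreasing, with bounded derivatives, G = 0 on
    [-1, 1] and G(s) = exp(-1/(s - 1)) for s > 1. Test the n-th equation with
    v = G(u_n), which lies in H^1_0 with gradient G'(u_n) grad u_n. Suppose
    |u_j| <= 1 for j < n. Where u_n > 1, the quadrature is nonnegative because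
    its weights are w_0 = 1, w_j <= 0 (j >= 1) with nonnegative partial sums,
    while u_{n-1} - u_n^3 < 0; where u_n < -1 all signs are reversed. So the
    left integrand is nonnegative, the right one is nonpositive, hence
    (u_{n-1} - u_n^3) G(u_n) = 0 a.e., that is |u_n| <= 1 a.e.

    Membership of G(u) in H^1_0 follows from the definition as a closure:
    if test functions phi_k converge to u in H^1, then the G o phi_k are test
    functions converging to G o u. The weak gradient passes to the limit, and
    for test functions it is integration by parts, i.e. Fubini and the
    fundamental theorem of calculus. *)

Require Import Defs.
From mathcomp Require Import all_boot all_order all_algebra.
From mathcomp Require Import all_classical all_reals all_analysis.
From mathcomp Require Import measurable_realfun ess_sup_inf.
From mathcomp Require Import ring lra zify.

Set Implicit Arguments.
Unset Strict Implicit.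
Unset Printing Implicit Defensive.

Import Order.TTheory GRing.Theory Num.Theory.
Import numFieldNormedType.Exports.

Local Open Scope classical_set_scope.
Local Open Scope ring_scope.

(** * Borel sets of R^d *)

Section rV_measurability.
Context {R : realType}.

Lemma measurable_rV_box d (A : 'I_d -> set (measurableTypeR R)) :
  (forall i, measurable (A i)) ->
  measurable [set x : 'rV[R]_d | forall i, A i (x ord0 i)].
Proof.
move=> mA; rewrite (_ : mkset _ = \big[setI/setT]_(i < d)
    [set x : 'rV[R]_d | A i (x ord0 i)]).
  apply: big_ind => // [|i _]; first exact: measurableI.
  by rewrite -[X in measurable X]setTI; exact: measurable_coord.
rewrite -bigcap_seq; apply/seteqP; split=> x /= H i => [_|]; first exact: H.
by apply: H; rewrite /= mem_index_enum.
Qed.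

(** The sigma-algebra is generated by the coordinates, so an open set is written as a countable
    union of boxes with rational centres and radii [1/(n+1)]. *)
Lemma open_measurable_rV d (U : set 'rV[R]_d) : open U -> measurable U.
Proof.
move=> oU.
pose box (p : 'rV[rat]_d * nat) := [set x : 'rV[R]_d | forall i,
  `]ratr (p.1 ord0 i) - p.2.+1%:R^-1, ratr (p.1 ord0 i) + p.2.+1%:R^-1[%classic
     (x ord0 i)].
have -> : U = \bigcup_p (if `[< box p `<=` U >] then box p else set0).
  apply/seteqP; split=> [x Ux|x [p _]]; last by case: asboolP => // + ?; apply.
  have /nbhs_ballP[e /= e0 eU] : nbhs x U by exact: open_nbhs_nbhs.
  (* Points of a box of radius [r] whose centre is within [r] of [x] lie within [2 r < e] of [x]. *)
  have [n ne] : exists n, n.+1%:R^-1 < e / 2.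
    have := near_infty_natSinv_lt (PosNum (divr_gt0 e0 (ltr0n R 2))).
    by move=> /filter_ex[n ?]; exists n.
  have n0 : 0 < n.+1%:R^-1 :> R by rewrite invr_gt0.
  move rE : n.+1%:R^-1 => r in ne n0.
  have qP i : {q : rat | ratr q \in `]x ord0 i - r, x ord0 i + r[}.
    by apply: cid; apply: rat_in_itvoo; lra.
  pose q : 'rV[rat]_d := \row_i sval (qP i).
  have qE i : x ord0 i - r < ratr (q ord0 i) < x ord0 i + r.
    by rewrite mxE; case: (qP i) => s /=; rewrite in_itv.
  exists (q, n) => //; case: asboolP => [_ i /=|].
    by have := qE i; rewrite in_itv/= rE; lra.
  case=> y /= yb; apply: eU; split=> // a i; rewrite (ord1 a) /ball/= ltr_norml.
  by move: (yb i) (qE i); rewrite /= in_itv/= rE; lra.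
apply: countable_bigcupT_measurable => [|p]; first exact: countableP.
case: asboolP => // _.
apply: (@measurable_rV_box d (fun i => `]ratr (p.1 ord0 i) - p.2.+1%:R^-1,
  ratr (p.1 ord0 i) + p.2.+1%:R^-1[%classic)) => i.
exact: measurable_itv.
Qed.

Lemma continuous_measurable_rV d (f : 'rV[R]_d -> R) :
  continuous f -> measurable_fun setT (f : 'rV[R]_d -> measurableTypeR R).
Proof.
move=> /continuousP cf.
apply: (measurability _ (measurable_realfun.RGenOpens.measurableE R)).
move=> _ [_ [a [b ->] <-]]; rewrite setTI; apply: open_measurable_rV.
exact/cf/interval_open.
Qed.

Lemma lebesgue_rV_cube_lty d (M : R) :
  (lebesgue_rV R d [set x | forall i, `[(- M)%R, M]%classic (x ord0 i)] < +oo)%E.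
Proof.
rewrite (@lebesgue_rV_box R d (fun=> `[- M, M]%classic))//.
rewrite -ge0_fin_numE ?prode_ge0//.
apply: (big_ind (fun x => x \is a fin_num)) => // [x y|i _]; first exact: fin_numM.
by rewrite lebesgue_measure_itv/=; case: ifP.
Qed.

End rV_measurability.

(** * Integrals of partial derivatives *)

Section integral_partial.
Context {R : realType}.
Implicit Types d : nat.

(** Supports are confined to a product of intervals because its slices along a coordinate are again
    cubes, as the induction on [d] requires. *)
Definition cube d (M : R) : set 'rV[R]_d :=
  [set x | forall i, `[(- M)%R, M]%classic (x ord0 i)].

Lemma cube_compact d M : compact (@cube d M).
Proof.
apply: (@rV_compact R d (fun=> `[(- M)%R, M]%classic)) => i.
exact: segment_compact.
Qed.

Lemma measurable_cube d M : measurable (@cube d M).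
Proof. by apply: (@measurable_rV_box R d (fun=> `[(- M)%R, M]%classic)) => i. Qed.

Lemma continuous_cube_bounded d M (g : 'rV[R]_d -> R) : continuous g ->
  (forall x, ~ cube M x -> g x = 0) ->
  exists B : R, 0 <= B /\ forall x, `|g x| <= B.
Proof.
move=> cg g0.
have : compact (g @` cube M).
  by apply: continuous_compact; [exact: continuous_subspaceT|exact: cube_compact].
move=> /compact_bounded[B [_ /(_ (`|B| + 1))]] gB.
exists (`|B| + 1); split=> [|x]; first by rewrite addr_ge0.
have [Kx|/g0 ->] := pselect (cube M x); last by rewrite normr0 addr_ge0.
apply: gB; last by exists x.
by rewrite (le_lt_trans (ler_norm B))// ltrDl.
Qed.

Lemma continuous_cube_integrable d M (g : 'rV[R]_d -> R) : continuous g ->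
  (forall x, ~ cube M x -> g x = 0) ->
  (lebesgue_rV R d).-integrable setT (EFin \o g).
Proof.
move=> cg g0; have [B [_ gB]] := continuous_cube_bounded cg g0.
have -> : EFin \o g = (EFin \o g) \_ (cube M).
  apply/funext => x; rewrite patchE; case: ifPn => // /negP.
  by rewrite inE => /g0/= ->.
apply/(integrable_mkcond _ (@measurable_cube d M)).
apply: measurable_bounded_integrable.
- exact: measurable_cube.
- exact: lebesgue_rV_cube_lty.
- exact: measurable_funTS (continuous_measurable_rV cg).
- exists B; split; first exact: num_real.
  by move=> x /ltW Bx y _; exact: le_trans (gB y) Bx.
Qed.

Lemma integral_derive1_0 (M : R) (g : R -> R) :
  (forall x, derivable g x 1) -> continuous ('D_1 g) ->
  (forall x, ~ `[- M, M]%classic x -> g x = 0) ->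
  (forall x, ~ `[- M, M]%classic x -> 'D_1 g x = 0) ->
  (\int[lebesgue_measure]_x ('D_1 g x)%:E = 0)%E.
Proof.
(* The hypotheses give no value at [M] and [- M] themselves, so the fundamental theorem is applied
   on a strictly larger interval, at whose ends [g] vanishes. *)
move=> dg cg g0 g'0; pose a := `|M| + 1.
have Ma : M < a by rewrite /a (le_lt_trans (ler_norm M))// ltrDl.
have a0 : 0 < a by rewrite /a ltr_wpDl.
transitivity (\int[lebesgue_measure]_(x in `[(- a)%R, a]) ('D_1 g x)%:E)%E.
  rewrite [RHS]integral_mkcond; apply: eq_integral => x _.
  rewrite patchE; case: ifPn => // /negP; rewrite inE => ax; rewrite g'0// => Mx.
  by apply: ax; move: Mx; rewrite /= !in_itv/=; lra.
have gc : continuous g.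
  by move=> x; apply: differentiable_continuous; apply/derivable1_diffP; exact: dg.
rewrite (@continuous_FTC2 _ ('D_1 g) g).
- have ga : g a = 0 by apply: g0; rewrite /= in_itv/=; lra.
  have gNa : g (- a) = 0 by apply: g0; rewrite /= in_itv/=; lra.
  by rewrite ga gNa subee.
- lra.
- exact: continuous_subspaceT.
- split=> [x _||]; first exact: dg.
  + exact/cvg_at_right_filter/gc.
  + exact/cvg_at_left_filter/gc.
- by move=> x _; rewrite derive1E.
Qed.

(* Derivatives along a line only see the restriction to that line. *)
Lemma derive_line (V W : normedModType R) (f : V -> R) (s : W -> R) x a v w :
  (forall h : R, s (h *: w + a) = f (h *: v + x)) ->
  (derivable f x v -> derivable s a w) /\ 'D_w s a = 'D_v f x.
Proof.
move=> sf; have sa : s a = f x by have := sf 0; rewrite !scale0r !add0r.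
have E : (fun h : R => h^-1 *: ((s \o shift a) (h *: w) - s a)) =
         (fun h : R => h^-1 *: ((f \o shift x) (h *: v) - f x)).
  by apply/funext => h; rewrite /= sf sa.
by rewrite /derivable /derive E.
Qed.

Lemma continuous_rV_consl d (y : 'rV[R]_d) :
  continuous (fun a : R => rV_cons (a, y)).
Proof.
move=> a A /nbhs_ballP[e e0 eA]; apply/nbhs_ballP; exists e => //= b ab.
apply: eA; split=> // i j; rewrite !mxE.
by case: unliftP => [k|] _ //=; exact: ballxx.
Qed.

Lemma continuous_rV_consr d (a : R) :
  continuous (fun y : 'rV[R]_d => rV_cons (a, y)).
Proof.
move=> y A /nbhs_ballP[e e0 eA]; apply/nbhs_ballP; exists e => //= z [_ yz].
apply: eA; split=> // i j; rewrite !mxE.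
by case: unliftP => [k|] _ /=; [exact: yz|exact: ballxx].
Qed.

Lemma cube_rV_cons d M (a : R) (y : 'rV[R]_d) :
  cube M (rV_cons (a, y)) <-> `[- M, M]%classic a /\ cube M y.
Proof.
split=> [H|[Ha Hy] i]; last by rewrite mxE; case: unliftP => [k|].
split; first by have := H ord0; rewrite mxE unlift_none.
by move=> i; have := H (lift ord0 i); rewrite mxE liftK.
Qed.

Lemma rV_cons_delta0 d (h a : R) (y : 'rV[R]_d) :
  rV_cons (h *: 1 + a, y) = h *: delta_mx ord0 ord0 + rV_cons (a, y).
Proof.
apply/rowP => i; rewrite !mxE eqxx/=; case: unliftP => [k|] ->/=.
  by rewrite mulr0 add0r.
by [].
Qed.

Lemma rV_cons_deltaS d (h a : R) (y : 'rV[R]_d) (j : 'I_d) :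
  rV_cons (a, h *: delta_mx ord0 j + y) =
  h *: delta_mx ord0 (lift ord0 j) + rV_cons (a, y).
Proof.
apply/rowP => i; rewrite !mxE eqxx/=; case: unliftP => [k|] ->/=.
  by rewrite !mxE eqxx/= (inj_eq lift_inj).
by rewrite mulr0 add0r.
Qed.

(** Induction on the dimension by Fubini: the first coordinate is split off, and the variable of
    differentiation always belongs to the inner integral. That integral vanishes by the
    one-dimensional case or by the induction hypothesis. *)
Lemma integral_partial0 d (i : 'I_d) M (f : 'rV[R]_d -> R) :
  (forall x, derivable f x (delta_mx ord0 i)) -> continuous (partial i f) ->
  (forall x, ~ cube M x -> f x = 0) ->
  (forall x, ~ cube M x -> partial i f x = 0) ->
  (\int[lebesgue_rV R d]_x (partial i f x)%:E = 0)%E.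
Proof.
elim: d i f => [[]//|d IH] i f df cf f0 f'0.
have F := continuous_cube_integrable cf f'0.
have /integrableP[mF Foo] := F.
pose P := (@lebesgue_measure R \x lebesgue_rV R d)%E.
(* In dimension [d.+1] the measure is by definition the push-forward of [P] under [rV_cons], so
   integrability is pulled back to the product before Fubini. *)
have iF : P.-integrable setT (EFin \o partial i f \o @rV_cons R d).
  apply/integrableP; split.
    exact: (measurable_comp (@measurableT _ 'rV[R]_d.+1)
      (@subsetT _ _) mF (@measurable_rV_cons R d)).
  apply: le_lt_trans Foo.
  rewrite (@ge0_integral_pushforward _ _ _ _ _ _ (@measurable_rV_cons R d) P setT
    (fun x => `|(partial i f x)%:E|)%E)//.
  exact: measurable_int (integrable_abse F).
rewrite (@integral_pushforward _ _ _ _ _ _ (@measurable_rV_cons R d) P setT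
  (fun x => (partial i f x)%:E)%E)//.
case: (unliftP ord0 i) => [j|] iE; subst i.
  rewrite -integral12_prod_meas1// integral0_eq// => a _.
  pose s (y : 'rV[R]_d) := f (rV_cons (a, y)).
  have L y := @derive_line _ _ f s (rV_cons (a, y)) y _ (delta_mx ord0 j)
    (fun h => congr1 f (rV_cons_deltaS h a y j)).
  have sE : partial j s = partial (lift ord0 j) f \o (fun y => rV_cons (a, y)).
    by apply/funext => y; exact: (L y).2.
  transitivity (\int[lebesgue_rV R d]_y (partial j s y)%:E)%E.
    by apply: eq_integral => y _; rewrite sE.
  apply: IH.
  - by move=> y; apply: (L y).1.
  - rewrite sE => y; apply: continuous_comp; last exact: cf.
    exact: continuous_rV_consr.
  - by move=> y yM; apply: f0 => /cube_rV_cons[].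
  - by move=> y yM; rewrite sE/= f'0// => /cube_rV_cons[].
rewrite -integral21_prod_meas1// integral0_eq// => y _.
pose s (a : R) := f (rV_cons (a, y)).
have L (a : R) := @derive_line _ _ f s (rV_cons (a, y)) a _ 1
  (fun h => congr1 f (rV_cons_delta0 h a y)).
have sE : 'D_1 s = partial ord0 f \o (fun a => rV_cons (a, y)).
  by apply/funext => a; exact: (L a).2.
transitivity (\int[lebesgue_measure]_a ('D_1 s a)%:E)%E.
  by apply: eq_integral => a _; congr EFin; exact: (esym (L a).2).
apply: (@integral_derive1_0 M).
- by move=> a; apply: (L a).1.
- rewrite sE => a; apply: continuous_comp; last exact: cf.
  exact: continuous_rV_consl.
- by move=> a aM; apply: f0 => /cube_rV_cons[].
- by move=> a aM; rewrite (L a).2; apply: f'0 => /cube_rV_cons[].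
Qed.

End integral_partial.

(** * Smooth and test functions *)

Section smooth_calculus.
Context {R : realType} {d : nat}.
Implicit Types (f g : 'rV[R]_d -> R) (i : 'I_d).

(** Recursion on the order peels off the derivative taken first, which suits the inductions for
    products and compositions; in the lists of [smooth] that derivative is the last entry. *)
Fixpoint smoothn (n : nat) f : Prop :=
  [/\ continuous f, forall i x, derivable f x (delta_mx ord0 i) &
      if n is n'.+1 then forall i, smoothn n' (partial i f) else True].

Lemma smoothnP f : smooth f <-> forall n, smoothn n f.
Proof.
split=> [+ n|fn s].
  elim: n f => [|n IH] f sf; have [df cf] := sf [::]; split=> // i.
  by apply: IH => s; have := sf (rcons s i); rewrite /= foldr_rcons.
elim/last_ind: s f fn => [|s i IH] f fn /=; first by have [] := fn 0%N.
rewrite foldr_rcons; apply: IH => n.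
by have [_ _] := fn n.+1; apply.
Qed.

Lemma smoothnW n f : smoothn n.+1 f -> smoothn n f.
Proof.
by elim: n f => [|n IH] f [cf df fn]; split=> // i; apply: IH; exact: fn.
Qed.

Lemma smoothnD n f g : smoothn n f -> smoothn n g -> smoothn n (f \+ g).
Proof.
elim: n f g => [|n IH] f g [cf df fn] [cg dg gn].
  split; last exact: I.
    by move=> x; apply: continuousD; [exact: cf|exact: cg].
  by move=> i x; apply: derivableD; [exact: df|exact: dg].
split=> [x|i x|i].
- by apply: continuousD; [exact: cf|exact: cg].
- by apply: derivableD; [exact: df|exact: dg].
- have -> : partial i (f \+ g) = partial i f \+ partial i g.
    by apply/funext => x; apply: deriveD; [exact: df|exact: dg].
  by apply: IH; [exact: fn|exact: gn].
Qed.

Lemma partialM i f g x : derivable f x (delta_mx ord0 i) ->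
  derivable g x (delta_mx ord0 i) ->
  partial i (f \* g) x = f x * partial i g x + g x * partial i f x.
Proof. exact: deriveM. Qed.

Lemma smoothnM n f g : smoothn n f -> smoothn n g -> smoothn n (f \* g).
Proof.
elim: n f g => [|n IH] f g hf hg; have [cf df fn] := hf; have [cg dg gn] := hg.
  split; last exact: I.
    by move=> x; apply: continuousM; [exact: cf|exact: cg].
  by move=> i x; apply: derivableM; [exact: df|exact: dg].
split=> [x|i x|i].
- by apply: continuousM; [exact: cf|exact: cg].
- by apply: derivableM; [exact: df|exact: dg].
- have -> : partial i (f \* g) = (f \* partial i g) \+ (g \* partial i f).
    by apply/funext => x; apply: partialM; [exact: df|exact: dg].
  apply: smoothnD; apply: IH.
  + exact: smoothnW.
  + exact: gn.
  + exact: smoothnW.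
  + exact: fn.
Qed.

(* Restricting to the line through x reduces this to the chain rule on R. *)
Lemma is_derive_comp_line (G : R -> R) (dG : R) f x (v : 'rV[R]_d) :
  is_derive (f x) (1 : R) G dG -> derivable f x v ->
  derivable (G \o f) x v /\ 'D_v (G \o f) x = dG * 'D_v f x.
Proof.
move=> dGf dfx.
have [s sE] : exists s : R -> R, forall h : R, s (h *: 1 + 0) = f (h *: v + x).
  exists (fun h => f (h *: v + x)) => h.
  by rewrite addr0; congr (f (_ *: _ + _)); exact: mulr1.
have s0 : s 0 = f x by have := sE 0; rewrite !scale0r !add0r.
have [/(_ dfx) ds sd] := derive_line sE.
have [dGs Gs] := @derive_line _ _ _ (G \o s) (G \o f) 0 x 1 v
  (fun h => congr1 G (esym (sE h))).
rewrite -s0 in dGf; have [dGs0 GsE] := is_derive1_comp dGf (derivableP ds).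
by split; [exact: dGs|rewrite Gs GsE sd].
Qed.

Lemma partial_comp (G : R -> R) (dG : R) i f x :
  is_derive (f x) (1 : R) G dG -> derivable f x (delta_mx ord0 i) ->
  partial i (G \o f) x = dG * partial i f x.
Proof. by move=> dGf dfx; exact: (is_derive_comp_line dGf dfx).2. Qed.

(* A smooth function of one real variable is given together with all its
   derivatives, G k.+1 being the derivative of G k. *)
Lemma smoothn_comp n (G : nat -> R -> R) f :
  (forall k (y : R), is_derive y (1 : R) (G k) (G k.+1 y)) -> smoothn n f ->
  forall k, smoothn n (G k \o f).
Proof.
move=> dG; elim: n f => [|n IH] f hf k; have [cf df fn] := hf.
all: have cGf : continuous (G k \o f).
1,3: by move=> x; apply: continuous_comp; [exact: cf|];
  apply: differentiable_continuous; apply/derivable1_diffP;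
  have [] := dG k (f x).
all: have dGf : forall i x, derivable (G k \o f) x (delta_mx ord0 i).
1,3: move=> i x; exact: (is_derive_comp_line (dG k (f x)) (df i x)).1.
1: by split.
split=> // i.
(* The chain rule raises the index of [G] by one, so the induction hypothesis has to hold for every
   [k]. *)
have -> : partial i (G k \o f) = (G k.+1 \o f) \* partial i f.
  by apply/funext => x; exact: partial_comp.
by apply: smoothnM; [apply: IH; exact: smoothnW|exact: fn].
Qed.

Lemma smooth_partial i f : smooth f -> smooth (partial i f).
Proof.
by move=> /smoothnP sf; apply/smoothnP => n; have [_ _] := sf n.+1; exact.
Qed.

Lemma smoothM f g : smooth f -> smooth g -> smooth (f \* g).
Proof.
by move=> /smoothnP sf /smoothnP sg; apply/smoothnP => n; exact: smoothnM.
Qed.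

Lemma smooth_comp (G : nat -> R -> R) f :
  (forall k (y : R), is_derive y (1 : R) (G k) (G k.+1 y)) ->
  smooth f -> smooth (G 0 \o f).
Proof. by move=> dG /smoothnP sf; apply/smoothnP => n; exact: smoothn_comp. Qed.

Lemma smooth_continuous f : smooth f -> continuous f.
Proof. by move=> /(_ [::])[]. Qed.

Lemma smooth_derivable f i x : smooth f -> derivable f x (delta_mx ord0 i).
Proof. by move=> /(_ [::])[df _]; exact: df. Qed.

End smooth_calculus.

(** * Stability, boundedness and integrals of test functions *)

Section test_functions.
Context {R : realType} {d : nat}.
Variable Omega : set 'rV[R]_d.
Implicit Types (f g : 'rV[R]_d -> R) (i : 'I_d).
Local Notation mu := (lebesgue_rV R d).

(** A closed subset of a compact set is compact. Derivatives, products and compositions of test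
    functions are then handled by comparing supports. *)
Lemma test_function_smaller f g : test_function Omega f -> smooth g ->
  [set x | g x != 0] `<=` closure [set x | f x != 0] -> test_function Omega g.
Proof.
move=> [sf Kf fO] sg gf.
have gf' : closure [set x | g x != 0] `<=` closure [set x | f x != 0].
  apply: subset_trans (closureS gf) _.
  by rewrite -(closure_id _).1//; exact: closed_closure.
split=> //; last exact: subset_trans gf' fO.
by apply: subclosed_compact gf' => //; exact: closed_closure.
Qed.

Lemma test_function_partial f i : test_function Omega f ->
  test_function Omega (partial i f).
Proof.
move=> tf; have [sf _ _] := tf; apply: (test_function_smaller tf).
  exact: smooth_partial.
move=> x /=; apply: contraPP => xf; apply/negP; rewrite negbK; apply/eqP.
(* Off the closed support [f] vanishes on a whole neighbourhood, so its derivative there is that of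
   a constant. *)
rewrite -(derive_cst (0 : R) x (delta_mx ord0 i)); apply: near_eq_derive.
have : nbhs x (~` closure [set x | f x != 0]).
  by apply: open_nbhs_nbhs; split=> //; apply/closed_openC/closed_closure.
apply: filterS => y yf; apply/eqP/negPn/negP => fy; apply: yf.
exact: subset_closure.
Qed.

Lemma test_functionM f g : test_function Omega f -> smooth g ->
  test_function Omega (f \* g).
Proof.
move=> tf sg; have [sf _ _] := tf; apply: (test_function_smaller tf).
  exact: smoothM.
by move=> x /=; rewrite mulf_eq0 negb_or => /andP[fx _]; apply: subset_closure.
Qed.

Lemma test_function_comp (G : nat -> R -> R) f :
  (forall k (y : R), is_derive y (1 : R) (G k) (G k.+1 y)) -> G 0%N 0 = 0 ->
  test_function Omega f -> test_function Omega (G 0%N \o f).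
Proof.
move=> dG G0 tf; have [sf _ _] := tf; apply: (test_function_smaller tf).
  exact: smooth_comp.
move=> x /= Gfx; apply: subset_closure => /=; apply: contraNneq Gfx => ->.
by rewrite G0.
Qed.

Lemma test_function_eq0 f x : test_function Omega f -> ~ Omega x -> f x = 0.
Proof.
move=> [_ _ fO] xO; apply/eqP/negPn/negP => fx; apply: xO; apply: fO.
exact: subset_closure.
Qed.

(** The norm of a row vector is the largest absolute value of its entries, so a bounded support lies
    in a cube. *)
Lemma test_function_cube f : test_function Omega f ->
  exists M, forall x, ~ cube M x -> f x = 0.
Proof.
move=> [_ /compact_bounded[M [_ /(_ (`|M| + 1)) fM]] _].
exists (`|M| + 1) => x xM; apply/eqP/negPn/negP => fx; apply: xM => i.
have Mlt : M < `|M| + 1 by rewrite (le_lt_trans (ler_norm M))// ltrDl.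
have := fM Mlt x (@subset_closure _ [set x | f x != 0] x fx).
rewrite /= in_itv/= -ler_norml; apply: le_trans.
by rewrite /Num.norm/= mx_normrE (le_bigmax _ _ (ord0, i)).
Qed.

Lemma test_function_continuous f : test_function Omega f -> continuous f.
Proof. by case=> sf _ _; exact: smooth_continuous. Qed.

Lemma test_function_bounded f : test_function Omega f ->
  exists B : R, 0 <= B /\ forall x, `|f x| <= B.
Proof.
move=> tf; have [M fM] := test_function_cube tf.
exact: continuous_cube_bounded (test_function_continuous tf) fM.
Qed.

Lemma test_function_measurable f : test_function Omega f ->
  measurable_fun setT f.
Proof.
by move=> tf; exact: continuous_measurable_rV (test_function_continuous tf).
Qed.

Lemma test_function_integrable f : test_function Omega f ->
  mu.-integrable setT (EFin \o f).
Proof.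
move=> tf; have [M fM] := test_function_cube tf.
exact: continuous_cube_integrable (test_function_continuous tf) fM.
Qed.

Lemma integral_test_function (F : 'rV[R]_d -> R) :
  (forall x, ~ Omega x -> F x = 0) ->
  (\int[mu]_(x in Omega) (F x)%:E = \int[mu]_x (F x)%:E)%E.
Proof.
move=> F0; rewrite integral_mkcond; apply: eq_integral => x _.
by rewrite patchE; case: ifPn => // /negP; rewrite inE => /F0 ->.
Qed.

Lemma integral_test_partial f i : test_function Omega f ->
  (\int[mu]_(x in Omega) (partial i f x)%:E = 0)%E.
Proof.
move=> tf; have tf' := test_function_partial i tf; have [sf _ _] := tf.
rewrite integral_test_function => [|x]; last exact: test_function_eq0.
have [M fM] := test_function_cube tf; have [M' fM'] := test_function_cube tf'.
have cubeW (a b : R) x : a <= b -> cube a x -> @cube R d b x.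
  by move=> ab ax j; have := ax j; rewrite /= !in_itv/=; lra.
apply: (@integral_partial0 _ _ _ (Num.max M M')).
- by move=> x; exact: smooth_derivable.
- exact: test_function_continuous tf'.
- move=> x xM; apply: fM; apply: contra_not xM; apply: cubeW.
  by rewrite le_max lexx.
- move=> x xM; apply: fM'; apply: contra_not xM; apply: cubeW.
  by rewrite le_max lexx orbT.
Qed.

End test_functions.

(** * A smooth cutoff *)

Section flat_cutoff.
Context {R : realType}.
Implicit Types (p : {poly R}) (x y : R).

(** The functions [p(1/x) exp(-1/x)], extended by zero, form a family closed under differentiation,
    so smoothness reduces to first derivatives. *)
Definition flat p x : R := if 0 < x then p.[x^-1] * expR (- x^-1) else 0.

(** With [y = 1/x], the derivative of [p(y) exp(-y)] in [x] is [y^2 (p(y) - p'(y)) exp(-y)]. *)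
Definition flat_deriv p : {poly R} := 'X^2 * (p - p^`()).

Lemma flat_le0 p x : x <= 0 -> flat p x = 0.
Proof. by rewrite /flat; case: ltP. Qed.

(** With [y = 1/x], the exponential series gives [y^i exp(-y) <= i!], which bounds each monomial. *)
Lemma flat_bounded p : exists C : R, 0 <= C /\ forall x, `|flat p x| <= C.
Proof.
exists (\sum_(i < size p) `|p`_i| * i`!%:R); split=> [|x].
  by apply: sumr_ge0 => i _; rewrite mulr_ge0.
rewrite /flat; case: ifPn => [x0|_]; last first.
  by rewrite normr0; apply: sumr_ge0 => i _; rewrite mulr_ge0.
have y0 : 0 < x^-1 by rewrite invr_gt0.
rewrite horner_coef mulr_suml (le_trans (ler_norm_sum _ _ _))//.
apply: ler_sum => i _; rewrite -mulrA normrM ler_wpM2l//.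
rewrite ger0_norm ?mulr_ge0 ?expR_ge0 ?exprn_ge0 ?(ltW y0)//.
rewrite expRN ler_pdivrMr ?expR_gt0// mulrC -ler_pdivrMr ?ltr0n ?fact_gt0//.
case: {i}(nat_of_ord i) => [|i].
  rewrite expr0 fact0 divr1 -[leLHS]addr0.
  by rewrite (le_trans _ (expR_ge1Dx _))// lerD2l ltW.
by apply: le_trans (expR_ge1Dxn i (ltW y0)); rewrite lerDr.
Qed.

Lemma flatMX p x : flat ('X * p) x = x^-1 * flat p x.
Proof.
by rewrite /flat; case: ifP => _; rewrite ?mulr0// hornerM hornerX mulrA.
Qed.

Lemma is_derive_flat0 p : is_derive (0 : R) 1 (flat p) 0.
Proof.
(* The bound for ['X * ('X * p)] yields [|flat p x| <= C x^2]; hence the difference quotient at [0]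
   is at most [C |x|]. *)
have [C [C0 FC]] := flat_bounded ('X * ('X * p)).
have flat_sq x : `|x^-1 * flat p x| <= C * `|x|.
  have [x0|x0] := leP x 0; first by rewrite flat_le0// mulr0 normr0 mulr_ge0.
  rewrite -ler_pdivrMr ?normr_gt0 ?gt_eqF// (le_trans _ (FC x))//.
  by rewrite 2!flatMX [leRHS]normrM normfV mulrC.
suff cvg0 : (fun h : R => h^-1 *: ((flat p \o shift 0) (h *: 1) - flat p 0))
    @ 0^' --> (0 : R).
  apply: DeriveDef; first by apply/cvg_ex; exists 0.
  exact: cvg_lim cvg0.
have Ce : 0 < C + 1 by rewrite ltr_wpDl.
apply/cvgr0Pnorm_le => e e0; near=> h.
rewrite /= [flat p 0]flat_le0// subr0 addr0 [h *: 1]mulr1 (le_trans (flat_sq h))//.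
have : `|h| <= e / (C + 1).
  near: h; apply: dnbhs0_le; exact: divr_gt0.
rewrite ler_pdivlMr// => /(le_trans _); apply.
by rewrite mulrC ler_wpM2l// lerDl.
Unshelve. all: by end_near. Qed.

Lemma is_derive_flat p x : is_derive x 1 (flat p) (flat (flat_deriv p) x).
Proof.
have [x0|x0|->] := ltgtP x 0; last first.
- rewrite (flat_le0 (flat_deriv p) (lexx 0)); exact: is_derive_flat0.
- have dV : is_derive x 1 (fun y : R => y^-1) (- x ^- 2).
    apply: is_derive_eq (is_deriveV _ (is_derive_id x 1)) _.
      by rewrite gt_eqF.
    exact: mulr1.
  have d1 := is_derive1_comp (is_derive_poly p x^-1) dV.
  have d2 := @is_derive1_comp R expR (fun y => - y^-1) x _ _
    (is_derive_expR (- x^-1)) (is_deriveN dV).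
  have := is_deriveM d1 d2.
  set D := (X in is_derive _ _ _ X) => dD.
  have -> : flat (flat_deriv p) x = D.
    rewrite /flat x0 /flat_deriv /D /= !hornerE /GRing.scale/=.
    by rewrite exprVn; ring.
  apply: near_eq_is_derive dD; near=> y.
  by rewrite /flat ifT//; near: y; exact: lt_nbhsr.
- rewrite (flat_le0 _ (ltW x0)).
  apply: near_eq_is_derive (is_derive_cst (0 : R) x 1); near=> y.
  by rewrite flat_le0// ltW//; near: y; exact: lt_nbhsl.
Unshelve. all: by end_near. Qed.

(** The sign of [G 0] detects values outside [[-1, 1]] and that of [G 1] controls the gradient term;
    the bounds on [G 1] and [G 2] make [G 0] and [G 1] Lipschitz. *)
Lemma smooth_odd_cutoff : exists G : nat -> R -> R,
  [/\ forall k y, is_derive y 1 (G k) (G k.+1 y),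
      forall k, exists C : R, 0 <= C /\ forall y, `|G k y| <= C,
      forall y, 0 <= G 1 y,
      forall y, `|y| <= 1 -> G 0 y = 0 &
      (forall y, 1 < y -> 0 < G 0 y) /\ (forall y, y < -1 -> G 0 y < 0)].
Proof.
pose F k := flat (iter k flat_deriv 1).
have dF k y : is_derive y 1 (F k) (F k.+1 y) by exact: is_derive_flat.
(* Odd reflection of the shifted cutoff; each derivative of the reflected term brings a factor [-1],
   whence the power. *)
pose G k y := F k (y - 1) - (-1) ^+ k * F k (- y - 1).
have F0_gt0 y : 0 < y -> 0 < F 0%N y.
  by move=> y0; rewrite /F /flat /= y0 hornerC mul1r expR_gt0.
have F0_le0 k y : y <= 0 -> F k y = 0 by exact: flat_le0.
have F1_ge0 y : 0 <= F 1%N y.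
  rewrite /F /flat /=; case: ifP => // _; rewrite /flat_deriv derivC subr0 !hornerE.
  by rewrite mulr_ge0 ?expR_ge0// sqr_ge0.
exists G; split.
- move=> k y.
  have d1 : is_derive y 1 (F k \o (fun z => z - 1)) (F k.+1 (y - 1) * (1 - 0)).
    exact: (@is_derive1_comp R (F k) (fun z => z - 1) y _ _ (dF k (y - 1))
      (is_deriveB (is_derive_id y 1) (is_derive_cst (1:R) y 1))).
  have d2 : is_derive y 1 (F k \o (fun z => - z - 1))
      (F k.+1 (- y - 1) * (- 1 - 0)).
    exact: (@is_derive1_comp R (F k) (fun z => - z - 1) y _ _ (dF k (- y - 1))
      (is_deriveB (is_deriveNid y 1) (is_derive_cst (1:R) y 1))).
  apply: is_derive_eq (is_deriveB d1 (is_deriveZ ((-1) ^+ k) d2)) _.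
  by rewrite /G exprS /GRing.scale/=; ring.
- move=> k; have [C [C0 FC]] := flat_bounded (iter k flat_deriv 1).
  exists (C + C); split=> [|y]; first exact: addr_ge0.
  rewrite (le_trans (ler_normB _ _))// lerD//; first exact: FC.
  by rewrite normrM normrX normrN1 expr1n mul1r; exact: FC.
- by move=> y; rewrite /G expr1 mulN1r opprK addr_ge0.
- by move=> y; rewrite ler_norml => /andP[y1 y2]; rewrite /G !F0_le0; lra.
- split=> y y1; rewrite /G expr0 mul1r.
    by rewrite [F 0 (- y - 1)]F0_le0 ?subr0 ?F0_gt0; lra.
  by rewrite [F 0 (y - 1)]F0_le0 ?sub0r ?oppr_lt0 ?F0_gt0; lra.
Qed.

End flat_cutoff.

(** * Square integrable functions *)

Section square_integral.
Context d (T : measurableType d) {R : realType}.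
Variables (mu : {measure set T -> \bar R}) (D : set T).
Hypothesis mD : measurable D.
Implicit Types f g : T -> R.

(** With the squared norm, estimates become pointwise inequalities under the integral, without
    square roots. *)
Definition sq_int f : \bar R := (\int[mu]_(x in D) (f x ^+ 2)%:E)%E.

Definition square_integrable f := measurable_fun D f /\ (sq_int f < +oo)%E.

Lemma sq_int_ge0 f : (0 <= sq_int f)%E.
Proof. by apply: integral_ge0 => x _; rewrite lee_fin sqr_ge0. Qed.

Lemma measurable_sq f : measurable_fun D f ->
  measurable_fun D (fun x => (f x ^+ 2)%:E).
Proof. by move=> mf; apply/measurable_EFinP; exact: measurable_funX. Qed.

Lemma measurable_sqM f (a : R) : measurable_fun D f ->
  measurable_fun D (fun x => (a%:E * (f x ^+ 2)%:E)%E).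
Proof. by move=> mf; apply: emeasurable_funM => //; exact: measurable_sq. Qed.

(** Stands in for the triangle inequality; the three terms match the splitting of the gradient error
    in the chain rule. *)
Lemma sq_int_le3 (F f1 f2 f3 : T -> R) (a b c : R) :
  0 <= a -> 0 <= b -> 0 <= c ->
  measurable_fun D F -> measurable_fun D f1 -> measurable_fun D f2 ->
  measurable_fun D f3 ->
  (forall x, D x -> F x ^+ 2 <= a * f1 x ^+ 2 + b * f2 x ^+ 2 + c * f3 x ^+ 2) ->
  (sq_int F <= a%:E * sq_int f1 + b%:E * sq_int f2 + c%:E * sq_int f3)%E.
Proof.
move=> a0 b0 c0 mF m1 m2 m3 Fle.
have pos (k : R) (h : T -> R) x : 0 <= k -> (0 <= k%:E * (h x ^+ 2)%:E)%E.
  by move=> k0; rewrite mule_ge0 ?lee_fin// sqr_ge0.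
rewrite /sq_int -!ge0_integralZl_EFin//; do ?[exact: measurable_sq];
  do ?[by move=> x _; rewrite lee_fin sqr_ge0].
rewrite -!ge0_integralD//; do ?[by move=> x _; rewrite ?adde_ge0 ?pos];
  do ?[exact: measurable_sqM]; last first.
  by apply: emeasurable_funD; exact: measurable_sqM.
apply: ge0_le_integral => //.
- by move=> x _; rewrite lee_fin sqr_ge0.
- exact: measurable_sq.
- by apply: emeasurable_funD; [apply: emeasurable_funD|]; exact: measurable_sqM.
Qed.

Lemma sq_int_le (F f : T -> R) (a : R) : 0 <= a ->
  measurable_fun D F -> measurable_fun D f ->
  (forall x, D x -> F x ^+ 2 <= a * f x ^+ 2) -> (sq_int F <= a%:E * sq_int f)%E.
Proof.
move=> a0 mF mf Fle.
have := @sq_int_le3 F f f f a 0 0 a0 (lexx 0) (lexx 0) mF mf mf mf.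
rewrite !mul0e !adde0; apply => x Dx.
by rewrite !mul0r !addr0 Fle.
Qed.

Lemma sq_int_sub f g : sq_int (f \- g) = sq_int (g \- f).
Proof. by apply: eq_integral => x _; congr EFin => /=; ring. Qed.

Lemma square_integrable_le (F f : T -> R) (a : R) : 0 <= a ->
  measurable_fun D F -> square_integrable f ->
  (forall x, D x -> F x ^+ 2 <= a * f x ^+ 2) -> square_integrable F.
Proof.
move=> a0 mF [mf foo] Fle; split=> //.
apply: le_lt_trans (sq_int_le a0 mF mf Fle) _.
by rewrite lte_mul_pinfty// lee_fin.
Qed.

Lemma square_integrable_mul f g : square_integrable f -> square_integrable g ->
  mu.-integrable D (fun x => (f x * g x)%:E).
Proof.
move=> [mf foo] [mg goo].
have isq h : measurable_fun D h -> (sq_int h < +oo)%E ->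
    mu.-integrable D (fun x => (h x ^+ 2)%:E).
  move=> mh hoo; apply/integrableP; split; first exact: measurable_sq.
  apply: le_lt_trans hoo; apply: ge0_le_integral => //.
  - by apply: measurableT_comp => //; exact: measurable_sq.
  - exact: measurable_sq.
  - by move=> x _; rewrite lee_fin ger0_norm ?sqr_ge0.
apply: (le_integrable mD _ _ (integrableD mD (isq f mf foo) (isq g mg goo))).
- by apply/measurable_EFinP; exact: measurable_funM.
- move=> x _; rewrite lee_fin [leRHS]ger0_norm ?addr_ge0 ?sqr_ge0// normrM.
  rewrite -[f x ^+ 2]real_normK ?num_real// -[g x ^+ 2]real_normK ?num_real//.
  by nra.
Qed.

Lemma Lnorm2_sqr f :
  ('N[mu]_2%:E[EFin \o (f \_ D)] * 'N[mu]_2%:E[EFin \o (f \_ D)] = sq_int f)%E.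
Proof.
have pos : (0 <= \int[mu]_x `|(EFin \o f \_ D) x| `^ 2)%E.
  by apply: integral_ge0 => x _; exact: poweR_ge0.
rewrite unlock poweR12_sqrt// -expe2 sqr_sqrte//.
rewrite /sq_int [RHS]integral_mkcond; apply: eq_integral => x _.
rewrite /= !patchE; case: ifPn => _.
  by rewrite powR_mulrn// real_normK ?num_real.
by rewrite normr0 ?poweR0r ?powR0.
Qed.

Lemma Lfun2P f : (f \_ D \in Lfun mu 2%:E) <-> square_integrable f.
Proof.
split.
  rewrite inE => /andP[]; rewrite inE/= => mf; rewrite inE/= => foo.
  split; first exact: (measurable_restrictT f mD).2.
  rewrite -Lnorm2_sqr lte_mul_pinfty ?Lnorm_ge0//.
  by rewrite ge0_fin_numE ?Lnorm_ge0.
move=> [mf foo]; rewrite inE; apply/andP; split; rewrite inE/=.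
  by have := (measurable_restrictT f mD).1 mf.
rewrite /finite_norm; move: foo; rewrite -Lnorm2_sqr.
have := Lnorm_ge0 mu 2%:E (EFin \o (f \_ D)).
by case: (Lnorm _ _ _) => [r _ _|//|//]; rewrite ?ltry.
Qed.

Definition sq_cvg0 (f : nat -> T -> R) :=
  forall e : R, 0 < e -> \forall k \near \oo, (sq_int (f k) <= e%:E)%E.

Lemma Lnorm2_cvg0P (f : nat -> T -> R) :
  ('N[mu]_2%:E[EFin \o (f k \_ D)] @[k --> \oo] --> 0)%E <-> sq_cvg0 f.
Proof.
split=> [fl e e0|fl].
  have s0 : 0 < Num.sqrt e by rewrite sqrtr_gt0.
  move/fine_cvgP : fl => [ffin /cvgr0Pnorm_le /(_ _ s0)].
  apply: filterS2 ffin => k fk.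
  rewrite /= ger0_norm ?fine_ge0 ?Lnorm_ge0// -lee_fin fineK// => kle.
  rewrite -Lnorm2_sqr.
  rewrite -[e](sqr_sqrtr (ltW e0)) expr2 EFinM.
  by rewrite lee_pmul ?Lnorm_ge0.
have small (e : R) : 0 < e ->
    \forall k \near \oo, ('N[mu]_2%:E[EFin \o (f k \_ D)] <= e%:E)%E.
  move=> e0; have := fl _ (mulr_gt0 e0 e0); apply: filterS => k.
  apply: contraTT; rewrite -!ltNge -Lnorm2_sqr => ke.
  by rewrite EFinM lte_pmul ?lee_fin// ltW.
apply/fine_cvgP; split.
  have := small 1 ltr01; apply: filterS => k ke.
  by rewrite ge0_fin_numE ?Lnorm_ge0// (le_lt_trans ke)// ltry.
apply/cvgr0Pnorm_le => e e0; have := small e e0; apply: filterS => k ke /=.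
rewrite ger0_norm ?fine_ge0 ?Lnorm_ge0// -lee_fin fineK//.
by rewrite ge0_fin_numE ?Lnorm_ge0// (le_lt_trans ke)// ltry.
Qed.

Lemma sq_cvg0_le (F f : nat -> T -> R) (a : R) : 0 <= a ->
  (forall k, measurable_fun D (F k)) -> (forall k, measurable_fun D (f k)) ->
  (forall k x, D x -> F k x ^+ 2 <= a * f k x ^+ 2) ->
  sq_cvg0 f -> sq_cvg0 F.
Proof.
move=> a0 mF mf Fle f0 e e0; have a1 : 0 < a + 1 by rewrite ltr_wpDl.
have := f0 _ (divr_gt0 e0 a1); apply: filterS => k fk.
rewrite (le_trans (sq_int_le a0 (mF k) (mf k) (Fle k)))//.
rewrite (@le_trans _ _ (a%:E * (e / (a + 1))%:E)%E)//.
  by rewrite lee_pmul ?lee_fin ?sq_int_ge0.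
by rewrite lee_fin mulrA ler_pdivrMr// mulrC ler_wpM2l ?(ltW e0)// lerDl.
Qed.

(** Weighted Young inequality, from [(|f| - e |g|)^2 >= 0]; the free parameter [e] lets it replace
    Cauchy-Schwarz. *)
Lemma integral_mul_le f g (e : R) : 0 < e ->
  measurable_fun D f -> measurable_fun D g ->
  (`|\int[mu]_(x in D) (f x * g x)%:E| <=
   e^-1%:E * sq_int f + e%:E * sq_int g)%E.
Proof.
move=> e0 mf mg; have e'0 : 0 < e^-1 by rewrite invr_gt0.
have mfg : measurable_fun D (fun x => (f x * g x)%:E).
  by apply/measurable_EFinP; exact: measurable_funM.
apply: le_trans (le_abse_integral mu mD mfg) _.
rewrite /sq_int -!ge0_integralZl_EFin ?(ltW e0) ?(ltW e'0)//;
  do ?[exact: measurable_sq]; do ?[by move=> x _; rewrite lee_fin sqr_ge0].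
rewrite -ge0_integralD//; do ?[exact: measurable_sqM];
  do ?[by move=> x _; rewrite mule_ge0 ?lee_fin ?sqr_ge0// ltW].
apply: ge0_le_integral => //.
- exact: measurableT_comp.
- by apply: emeasurable_funD; exact: measurable_sqM.
- move=> x _; rewrite lee_fin normrM.
  rewrite -[f x ^+ 2]real_normK ?num_real// -[g x ^+ 2]real_normK ?num_real//.
  have := sqr_ge0 (`|f x| - e * `|g x|).
  move: (normr_ge0 (f x)) (normr_ge0 (g x)); move: `|f x| `|g x| => a b a0 b0 ab.
  rewrite -(ler_pM2l e0) mulrDr !mulrA divff ?gt_eqF// mul1r.
  by have : 0 <= e * (a * b) by [rewrite !mulr_ge0// ltW]; nra.
Qed.

Lemma integral_mul_cvg (f_ : nat -> T -> R) f g :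
  (forall k, square_integrable (f_ k)) -> square_integrable f ->
  square_integrable g -> sq_cvg0 (fun k => f_ k \- f) ->
  (\int[mu]_(x in D) (f_ k x * g x)%:E @[k --> \oo] -->
   \int[mu]_(x in D) (f x * g x)%:E)%E.
Proof.
move=> Lf_ Lf Lg f_f.
have fin h : square_integrable h ->
    (\int[mu]_(x in D) (h x * g x)%:E)%E \is a fin_num.
  by move=> Lh; apply: integrable_fin_num => //; exact: square_integrable_mul.
rewrite -(fineK (fin _ Lf)); apply/fine_cvgP; split.
  by near=> k; exact: fin.
apply/cvgrPdist_le => e e0.
have [mg goo] := Lg; have [mf _] := Lf.
have gfin : sq_int g \is a fin_num by rewrite ge0_fin_numE ?sq_int_ge0.
have H0 : 0 < 1 + fine (sq_int g) by rewrite ltr_wpDr ?fine_ge0 ?sq_int_ge0.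
(* Once [sq_int (f_ k \- f) <= r^2], the Young bound with weight [r] is at most [r + r * sq_int g],
   which equals [e]. *)
pose r := e / (1 + fine (sq_int g)).
have r0 : 0 < r by rewrite divr_gt0.
have := f_f _ (mulr_gt0 r0 r0); apply: filterS => k fk /=.
have [mfk _] := Lf_ k.
rewrite -lee_fin -abse_EFin EFinB !fineK ?fin// -integralB_EFin//; last 2 first.
- exact: square_integrable_mul.
- exact: square_integrable_mul.
rewrite (eq_integral (fun x => ((f \- f_ k) x * g x)%:E)); last first.
  by move=> x _; rewrite -EFinB /= mulrBl.
apply: le_trans (integral_mul_le r0 _ mg) _; first exact: measurable_funB.
rewrite sq_int_sub -(fineK gfin).
rewrite (@le_trans _ _ (r^-1%:E * (r * r)%:E + r%:E * (fine (sq_int g))%:E)%E)//.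
  by rewrite leeD2r// lee_pmul ?lee_fin ?sq_int_ge0// invr_ge0 ltW.
rewrite -!EFinM -EFinD lee_fin mulrA mulVf ?gt_eqF// mul1r -{1}(mulr1 r) -mulrDr.
by rewrite /r divfK// gt_eqF.
Unshelve. all: by end_near. Qed.

End square_integral.

(** * Chain rule in the closure of the test functions *)

Section sobolev_chain_rule.
Context {R : realType} {d : nat}.
Variable Omega : set 'rV[R]_d.
Hypothesis oO : open Omega.
Local Notation mu := (lebesgue_rV R d).
Local Notation sq_int := (sq_int mu Omega).
Local Notation square_integrable := (square_integrable mu Omega).
Local Notation sq_cvg0 := (sq_cvg0 mu Omega).
Implicit Types (f u w : 'rV[R]_d -> R) (g q : 'I_d -> 'rV[R]_d -> R).

Let mO : measurable Omega := open_measurable_rV oO.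

Lemma in_L2P f : in_L2 Omega f <-> square_integrable f.
Proof. exact: Lfun2P. Qed.

Lemma test_function_square_integrable f : test_function Omega f ->
  square_integrable f.
Proof.
move=> tf; have [sf _ _] := tf; split.
  exact: measurable_funTS (test_function_measurable tf).
have /integrableP[_] := test_function_integrable (test_functionM tf sf).
rewrite /sq_int (@integral_test_function _ _ _ (fun x => f x ^+ 2));
  last first => [x Ox|].
  by rewrite (test_function_eq0 tf Ox) expr0n.
apply: le_lt_trans; rewrite le_eqVlt; apply/orP; left; apply/eqP.
by apply: eq_integral => x _; rewrite /= ger0_norm ?expr2// -expr2 sqr_ge0.
Qed.

(** The product of [f] and [psi] is a test function, so its derivative integrates to zero; the
    product rule splits that integral into the two terms of the identity. *)
Lemma test_function_weak_gradient f : test_function Omega f ->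
  is_weak_gradient Omega f (fun i => partial i f).
Proof.
move=> tf i psi tpsi; have [sf _ _] := tf; have [spsi _ _] := tpsi.
have L2 h : test_function Omega h -> square_integrable h.
  exact: test_function_square_integrable.
have i1 := square_integrable_mul mO (L2 _ tf) (L2 _ (test_function_partial i tpsi)).
have i2 := square_integrable_mul mO (L2 _ (test_function_partial i tf)) (L2 _ tpsi).
have := integral_test_partial i (test_functionM tf spsi).
rewrite (eq_integral
  (fun x => (f x * partial i psi x)%:E + (partial i f x * psi x)%:E)%E);
  last first.
  move=> x _; rewrite -EFinD partialM; [|exact: smooth_derivable..].
  by rewrite [psi x * _]mulrC.
rewrite integralD// => PQ; rewrite -[LHS](addeK _ (integrable_fin_num mO i2)).
by rewrite PQ add0e.
Qed.

(** For a fixed test function both sides of the defining identity are continuous under L^2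
    convergence. *)
Lemma weak_gradient_limit (w_ : nat -> 'rV[R]_d -> R)
    (q_ : nat -> 'I_d -> 'rV[R]_d -> R) w q :
  (forall k, is_weak_gradient Omega (w_ k) (q_ k)) ->
  (forall k, square_integrable (w_ k)) ->
  (forall k i, square_integrable (q_ k i)) ->
  square_integrable w -> (forall i, square_integrable (q i)) ->
  sq_cvg0 (fun k => w_ k \- w) -> (forall i, sq_cvg0 (fun k => q_ k i \- q i)) ->
  is_weak_gradient Omega w q.
Proof.
move=> wq Lw_ Lq_ Lw Lq w0 q0 i psi tpsi.
have Lpsi := test_function_square_integrable tpsi.
have Ldpsi := test_function_square_integrable (test_function_partial i tpsi).
have wl := integral_mul_cvg mO Lw_ Lw Ldpsi w0.
have ql := integral_mul_cvg mO (fun k => Lq_ k i) (Lq i) Lpsi (q0 i).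
have wqE : (fun k => \int[mu]_(x in Omega) (w_ k x * partial i psi x)%:E)%E =
    (fun k => - \int[mu]_(x in Omega) (q_ k i x * psi x)%:E)%E.
  by apply/funext => k; exact: wq.
by rewrite wqE in wl; exact: (cvg_unique _ wl (cvgeN ql)).
Qed.

(** Besides square integrability, only the approximation by test functions has to be checked: the
    weak gradient is inherited in the limit. *)
Lemma in_H10_limit (phi : nat -> 'rV[R]_d -> R) w q :
  (forall k, test_function Omega (phi k)) ->
  square_integrable w -> (forall i, square_integrable (q i)) ->
  sq_cvg0 (fun k => phi k \- w) ->
  (forall i, sq_cvg0 (fun k => partial i (phi k) \- q i)) ->
  in_H10 Omega w q.
Proof.
move=> tphi Lw Lq phiw phiq; split; last first.
  exists phi; split=> // [|i]; first exact/Lnorm2_cvg0P.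
  exact/Lnorm2_cvg0P.
split; [exact/in_L2P|by move=> i; exact/in_L2P|].
apply: (@weak_gradient_limit phi (fun k i => partial i (phi k))) => //.
- by move=> k; exact: test_function_weak_gradient.
- by move=> k; exact: test_function_square_integrable.
- by move=> k i; exact/test_function_square_integrable/test_function_partial.
Qed.

Lemma lipschitz_of_derive (G dG : R -> R) (C : R) :
  (forall y : R, is_derive y 1 G (dG y)) -> (forall y, `|dG y| <= C) ->
  forall a b, `|G a - G b| <= C * `|a - b|.
Proof.
move=> GdG dGC a b; wlog ab : a b / b <= a => [H|].
  by have [/H//|/ltW/H] := leP b a; rewrite distrC [`|b - a|]distrC.
have cG : {within `[b, a], continuous G}.
  apply: continuous_subspaceT => x; apply: differentiable_continuous.
  by apply/derivable1_diffP; have [] := GdG x.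
have [c _ ->] := MVT_segment ab (fun x _ => GdG x) cG.
by rewrite normrM ler_wpM2r.
Qed.

Lemma in_H10_comp (G : nat -> R -> R) u g :
  (forall k (y : R), is_derive y 1 (G k) (G k.+1 y)) ->
  (forall k, exists C : R, 0 <= C /\ forall y, `|G k y| <= C) -> G 0%N 0 = 0 ->
  in_H10 Omega u g ->
  in_H10 Omega (G 0%N \o u) (fun i x => G 1%N (u x) * g i x).
Proof.
move=> dG bG G0 [[/in_L2P Lu Lg _] [phi [tphi phiu phig]]].
have {}Lg i : square_integrable (g i) by exact/in_L2P/Lg.
have {phiu}phiu : sq_cvg0 (fun k => phi k \- u) by exact/Lnorm2_cvg0P.
have {phig}phig i : sq_cvg0 (fun k => partial i (phi k) \- g i).
  exact/Lnorm2_cvg0P/phig.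
have [C1 [C10 G1C]] := bG 1%N; have [C2 [C20 G2C]] := bG 2%N.
have lip0 := lipschitz_of_derive (dG 0%N) G1C.
have lip1 := lipschitz_of_derive (dG 1%N) G2C.
have mG k : measurable_fun setT (G k).
  apply: continuous_measurable_fun => x; apply: differentiable_continuous.
  by apply/derivable1_diffP; have [] := dG k x.
have [mu_ _] := Lu.
have mGu k : measurable_fun Omega (G k \o u) by exact: measurableT_comp.
have mphi k : measurable_fun Omega (phi k).
  exact: measurable_funTS (test_function_measurable (tphi k)).
have mpphi i k : measurable_fun Omega (partial i (phi k)).
  apply: measurable_funTS.
  exact: test_function_measurable (test_function_partial i (tphi k)).
have mGphi j k : measurable_fun Omega (G j \o phi k) by exact: measurableT_comp.
have mg i : measurable_fun Omega (g i) by have [] := Lg i.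
have sqr_le (a b : R) : 0 <= b -> `|a| <= b -> a ^+ 2 <= b ^+ 2.
  by move=> b0 ab; rewrite -[a ^+ 2]real_normK ?num_real// lerXn2r ?nnegrE.
have Gphi k i x :
    partial i (G 0%N \o phi k) x = G 1%N (phi k x) * partial i (phi k) x.
  have [sphi _ _] := tphi k.
  exact: partial_comp (dG 0%N (phi k x)) (smooth_derivable sphi).
apply: (@in_H10_limit (fun k => G 0%N \o phi k)).
- by move=> k; exact: test_function_comp.
- apply: (square_integrable_le mO (sqr_ge0 C1) _ Lu) => // x _.
  have := lip0 (u x) 0; rewrite G0 !subr0 => h.
  rewrite -[u x ^+ 2]real_normK ?num_real// -exprMn.
  by apply: sqr_le => //; rewrite mulr_ge0.
- move=> i; apply: (square_integrable_le mO (sqr_ge0 C1) _ (Lg i)).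
    by apply: measurable_funM => //; exact: mGu.
  move=> x _; rewrite exprMn ler_wpM2r ?sqr_ge0// sqr_le//; exact: G1C.
- apply: (sq_cvg0_le mO (sqr_ge0 C1) _ _ _ phiu).
  + by move=> k; exact: measurable_funB.
  + by move=> k; exact: measurable_funB.
  + move=> k x _; rewrite -[(_ \- _) x ^+ 2 in leRHS]real_normK ?num_real// -exprMn.
    by apply: sqr_le; [rewrite mulr_ge0|exact: lip0].
(* The bounded function partial i (phi m), close to g i, stands in for g i:
   this avoids extracting an a.e. convergent subsequence of phi. *)
- move=> i e e0.
  (* Each of the three error terms gets [e / 3]; dividing by [a + 1] covers a zero coefficient. *)
  have mul_small (a : R) (X : \bar R) : 0 <= a -> (0 <= X)%E ->
      (X <= (e / 3 / (a + 1))%:E)%E -> (a%:E * X <= (e / 3)%:E)%E.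
    move=> a0 X0 XE; have a1 : 0 < a + 1 by rewrite ltr_wpDl.
    rewrite (@le_trans _ _ (a%:E * (e / 3 / (a + 1))%:E)%E) ?lee_pmul ?lee_fin//.
    by rewrite mulrA ler_pdivrMr// mulrC ler_wpM2l ?lerDl// divr_ge0// ltW.
  have small (a : R) : 0 <= a -> 0 < e / 3 / (a + 1).
    by move=> a0; rewrite !divr_gt0// ltr_wpDl.
  (* The [3] comes from [(X + Y + Z)^2 <= 3 (X^2 + Y^2 + Z^2)], and [12] is [3 * 4], as two values
     of [G 1] differ by at most [2 C1]. *)
  have a1_ge0 : 0 <= 3 * C1 ^+ 2 by rewrite mulr_ge0// sqr_ge0.
  have a2_ge0 : 0 <= 12 * C1 ^+ 2 by rewrite mulr_ge0// sqr_ge0.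
  (* The index [m] is fixed before [k], because the tolerance for [phi k \- u] depends on the bound
     [B] of [partial i (phi m)]. *)
  have [m mE] := filter_ex (phig i _ (small _ a2_ge0)).
  have [B [B0 phiB]] := test_function_bounded (test_function_partial i (tphi m)).
  have a3_ge0 : 0 <= 3 * (C2 * B) ^+ 2 by rewrite mulr_ge0// sqr_ge0.
  apply: filterS2 (phig i _ (small _ a1_ge0)) (phiu _ (small _ a3_ge0)) => k gk uk.
  have : (sq_int (partial i (G 0%N \o phi k) \- (fun x => G 1%N (u x) * g i x))%R
      <= (3 * C1 ^+ 2)%:E * sq_int (partial i (phi k) \- g i)%R
       + (12 * C1 ^+ 2)%:E * sq_int (partial i (phi m) \- g i)%R
       + (3 * (C2 * B) ^+ 2)%:E * sq_int (phi k \- u)%R)%E.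
    apply: sq_int_le3 => //.
    + apply: measurable_funB; last by apply: measurable_funM => //; exact: mGu.
      rewrite (funext (Gphi k i)).
      by apply: measurable_funM => //; exact: mGphi.
    + exact: measurable_funB.
    + exact: measurable_funB.
    + exact: measurable_funB.
    + move=> x _; rewrite /= Gphi.
      set p := partial i (phi k) x; set pm := partial i (phi m) x.
      set a := G 1%N (phi k x); set b := G 1%N (u x); set c := g i x.
      (* The first term is small by convergence of the gradients, the second by the choice of [m],
         the third because [G 1] is Lipschitz and [pm] is bounded. *)
      have -> : a * p - b * c =
        a * (p - c) + (b - a) * (pm - c) + (a - b) * pm by ring.
      have h1 : (a * (p - c)) ^+ 2 <= C1 ^+ 2 * (p - c) ^+ 2.
        by rewrite exprMn ler_wpM2r ?sqr_ge0// sqr_le//; exact: G1C.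
      have h2 : ((b - a) * (pm - c)) ^+ 2 <= 4 * C1 ^+ 2 * (pm - c) ^+ 2.
        rewrite exprMn ler_wpM2r ?sqr_ge0//.
        have -> : 4 * C1 ^+ 2 = (C1 + C1) ^+ 2 by ring.
        apply: sqr_le; first by rewrite addr_ge0.
        by rewrite (le_trans (ler_normB _ _))// lerD//; exact: G1C.
      have h3 : ((a - b) * pm) ^+ 2 <= (C2 * B) ^+ 2 * (phi k x - u x) ^+ 2.
        rewrite -[(phi k x - u x) ^+ 2]real_normK ?num_real// -exprMn.
        apply: sqr_le; first by rewrite !mulr_ge0.
        rewrite normrM mulrAC ler_pM//; [exact: lip1|exact: phiB].
      move: h1 h2 h3; rewrite -!mulrA.
      set X := a * (p - c); set Y := (b - a) * (pm - c); set Z := (a - b) * pm.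
      move=> h1 h2 h3; have := sqr_ge0 (X - Y); have := sqr_ge0 (X - Z).
      by have := sqr_ge0 (Y - Z); lra.
  move/le_trans; apply; have -> : e%:E = ((e / 3)%:E + (e / 3)%:E + (e / 3)%:E)%E.
    by rewrite -!EFinD; congr EFin; field.
  by rewrite !leeD// mul_small// sq_int_ge0.
Qed.

End sobolev_chain_rule.

(** * Weights and the maximum principle *)

Section cq_weights.
Context {R : realType}.
Variable alpha : R.
Hypothesis alpha01 : 0 < alpha < 1.

Let alpha0 : 0 < alpha. Proof. by case/andP: alpha01. Qed.
Let alpha1 : alpha < 1. Proof. by case/andP: alpha01. Qed.

Lemma cq_weight0 : cq_weight alpha 0 = 1.
Proof. by rewrite /cq_weight big_ord0 expr0 fact0 !mulr1 divr1. Qed.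

(** The weights are the coefficients of [(1 - z)^alpha]; this division-free recursion drives every
    fact about their signs. *)
Lemma cq_weightS j :
  cq_weight alpha j.+1 * j.+1%:R = cq_weight alpha j * (j%:R - alpha).
Proof.
rewrite /cq_weight big_ord_recr/= factS natrM exprS; field.
by rewrite nat1r !pnatr_eq0 -lt0n fact_gt0.
Qed.

(** The weight of index [1] is [- alpha]; afterwards the recursion multiplies by positive factors,
    since [alpha < 1]. *)
Lemma cq_weightS_le0 j : cq_weight alpha j.+1 <= 0.
Proof.
elim: j => [|j IH].
  by rewrite -[cq_weight _ _]mulr1 cq_weightS cq_weight0 mul1r sub0r oppr_le0 ltW.
have j0 : 0 < j.+2%:R :> R by rewrite ltr0n.
rewrite -(ler_pM2r j0) cq_weightS mul0r mulr_le0_ge0//.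
by rewrite subr_ge0 (le_trans (ltW alpha1))// ler1n.
Qed.

(* Telescoping: the partial sums of the coefficients of (1 - z)^alpha are the
   coefficients of (1 - z)^(alpha - 1). *)
Lemma sum_cq_weight n :
  alpha * \sum_(j < n.+1) cq_weight alpha j = - (cq_weight alpha n.+1 * n.+1%:R).
Proof.
elim: n => [|n IH].
  by rewrite big_ord1 cq_weightS cq_weight0; ring.
by rewrite big_ord_recr/= mulrDr IH [in RHS]cq_weightS; ring.
Qed.

Lemma sum_cq_weight_ge0 n : 0 <= \sum_(j < n.+1) cq_weight alpha j.
Proof.
rewrite -(pmulr_rge0 _ alpha0) sum_cq_weight oppr_ge0 mulr_le0_ge0//.
exact: cq_weightS_le0.
Qed.

(** Earlier values are at most [1] and carry nonpositive weights, while the last exceeds [1] and has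
    weight [1]. Replacing them all by [1] can only lower the sum, to [1 - a 0] times a partial sum
    of the weights, which is nonnegative. *)
Lemma cq_sum_ge0 (a : nat -> R) n : (0 < n)%N ->
  (forall j, (j < n)%N -> `|a j| <= 1) -> 1 < a n ->
  0 <= \sum_(1 <= j < n.+1) cq_weight alpha (n - j) * (a j - a 0%N).
Proof.
case: n => // n _ a1 an.
have a01 : a 0%N <= 1 by rewrite (le_trans (ler_norm _))// a1.
rewrite big_nat_recr//= subnn cq_weight0 mul1r.
have S : \sum_(1 <= j < n.+1) cq_weight alpha (n.+1 - j) * (1 - a 0%N) <=
         \sum_(1 <= j < n.+1) cq_weight alpha (n.+1 - j) * (a j - a 0%N).
  rewrite !big_nat; apply: ler_sum => j /andP[_ jn].
  rewrite subSn// ler_wnM2l ?cq_weightS_le0// lerD2r.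
  by rewrite (le_trans (ler_norm _))// a1.
have : 0 <= (\sum_(j < n.+1) cq_weight alpha j) * (1 - a 0%N).
  by rewrite mulr_ge0 ?sum_cq_weight_ge0// subr_ge0.
(* The order of summation is reversed: as [j] runs from [1] to [n], so does [n.+1 - j]. *)
have -> : \sum_(j < n.+1) cq_weight alpha j =
    1 + \sum_(1 <= j < n.+1) cq_weight alpha (n.+1 - j).
  rewrite big_ord_recl cq_weight0 big_nat_rev/= big_add1/= big_mkord.
  congr (_ + _); apply: eq_bigr => i _; congr (cq_weight alpha _).
  by have := ltn_ord i; rewrite /= /bump /=; lia.
rewrite -mulr_suml in S; rewrite mulrDl mul1r => S0.
by move: S an; set X := \sum_(1 <= j < _) _; set Y := X * _ in S0 *; lra.
Qed.

Lemma cq_sum_le0 (a : nat -> R) n : (0 < n)%N ->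
  (forall j, (j < n)%N -> `|a j| <= 1) -> a n < -1 ->
  \sum_(1 <= j < n.+1) cq_weight alpha (n - j) * (a j - a 0%N) <= 0.
Proof.
move=> n0 a1 an; have := @cq_sum_ge0 (fun j => - a j) n n0.
rewrite ltrNr => /(_ _ an); rewrite -oppr_ge0 -sumrN.
under [X in _ -> 0 <= X]eq_bigr => j _ do rewrite -mulrN opprB addrC -[a 0%N]opprK.
by apply=> j jn; rewrite normrN a1.
Qed.

End cq_weights.

(** * Comparison principle for the elliptic problem of one time step *)

Section maximum_principle.
Context {R : realType} {d : nat}.
Variable Omega : set 'rV[R]_d.
Local Notation mu := (lebesgue_rV R d).

Lemma Lp_norm_infty_le1P (f : 'rV[R]_d -> R) :
  (Lp_norm +oo Omega f <= 1)%E <-> {ae mu, forall x, Omega x -> `|f x| <= 1}.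
Proof.
rewrite /Lp_norm unlock; case: ifPn => mu0.
  split=> [/ess_supP|H].
    by apply: filterS => x /= fx Ox; move: fx; rewrite patchE mem_set// lee_fin.
  apply/ess_supP; apply: filterS H => x /= fx; rewrite patchE; case: ifPn => [|_].
    by rewrite inE => /fx; rewrite lee_fin.
  by rewrite normr0 lee_fin.
(* If the whole space has measure zero, the norm is [0] by convention and the exceptional set may be
   everything. *)
split=> // _; exists setT; split=> //.
by apply/eqP; rewrite eq_le measure_ge0 andbT leNgt.
Qed.

(** Only the signs of [w] and [f] where [|u| > 1] enter, which separates the elliptic argument from
    the time discretization. *)
Lemma weak_dirichlet_le1 (kappa : R) (w u f : 'rV[R]_d -> R) :
  open Omega -> measurable_fun Omega w -> measurable_fun Omega f ->
  weak_dirichlet kappa Omega w u f ->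
  {ae mu, forall x, Omega x ->
     (1 < u x -> 0 <= w x /\ f x < 0) /\ (u x < -1 -> w x <= 0 /\ 0 < f x)} ->
  {ae mu, forall x, Omega x -> `|u x| <= 1}.
Proof.
move=> oO mw mf [g [Hu Heq]] wf.
have mO := open_measurable_rV oO.
have [[/in_L2P Lu Lg _] _] := Hu.
have [mu_ _] := Lu oO.
have mg i : measurable_fun Omega (g i) by have /(in_L2P oO)[] := Lg i.
have [G [dG bG G1 G0 [Ggt Glt]]] := @smooth_odd_cutoff R.
have mG k : measurable_fun setT (G k).
  apply: continuous_measurable_fun => x; apply: differentiable_continuous.
  by apply/derivable1_diffP; have [] := dG k x.
have mGu k : measurable_fun Omega (fun x => G k (u x)) by exact: measurableT_comp.
have G00 : G 0%N 0 = 0 by apply: G0; rewrite normr0.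
have := Heq _ _ (in_H10_comp oO dG bG G00 Hu).
set L := (X in (\int[_]_(x in _) X x)%E = _).
set Q := (X in _ = (\int[_]_(x in _) X x)%E).
have mQ : measurable_fun Omega Q.
  by apply/measurable_EFinP; apply: measurable_funM => //; exact: mGu.
have mL : measurable_fun Omega L.
  apply/measurable_EFinP; apply: measurable_funD.
    by apply: measurable_funM => //; exact: mGu.
  apply: measurable_funM => //; apply: measurable_sum => i.
  by apply: measurable_funM => //; apply: measurable_funM => //; exact: mGu.
have sign : {ae mu, forall x, Omega x ->
    0 <= w x * G 0%N (u x) /\ f x * G 0%N (u x) <= 0}.
  apply: filterS wf => x wfx /wfx[ugt ult].
  have [u1|u1] := ltP 1 (u x).
    have [w0 f0] := ugt u1; have G_gt0 := Ggt _ u1.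
    by split; [rewrite mulr_ge0// ltW|rewrite mulr_le0_ge0// ltW].
  have [u2|u2] := ltP (u x) (-1).
    have [w0 f0] := ult u2; have G_lt0 := Glt _ u2.
    by split; [rewrite mulr_le0// ltW|rewrite mulr_ge0_le0// ltW].
  by rewrite G0 ?mulr0 ?lexx// ler_norml u2 u1.
(* Passing to absolute values lets the extended-real integrals be compared from measurability and
   signs alone. *)
have LE : (\int[mu]_(x in Omega) L x = \int[mu]_(x in Omega) `|L x|)%E.
  apply: ae_eq_integral => //; first exact: measurableT_comp.
  apply: filterS sign => x /[apply] -[wG _].
  rewrite gee0_abs// /L lee_fin addr_ge0// mulr_ge0 ?sqr_ge0// sumr_ge0// => i _.
  by rewrite mulrCA mulr_ge0// -expr2 sqr_ge0.
have QE : (\int[mu]_(x in Omega) Q x = - \int[mu]_(x in Omega) `|Q x|)%E.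
  rewrite -integral_ge0N//; apply: ae_eq_integral => //.
    by apply: measurableT_comp => //; exact: measurableT_comp.
  by apply: filterS sign => x /[apply] -[_ fG]; rewrite lee0_abs ?oppeK// lee_fin.
rewrite LE QE => LQ.
(* A nonnegative integral equals the opposite of a nonnegative one, so both vanish. *)
have : (\int[mu]_(x in Omega) `|Q x| = 0)%E.
  apply/eqP; rewrite eq_le integral_ge0// andbT -oppe_ge0 -LQ.
  exact: integral_ge0.
move=> /(ae_eq_integral_abs _ mO mQ) Q0.
apply: filterS2 wf Q0 => x wfx Q0x Ox.
have [ugt ult] := wfx Ox.
have /eqP := Q0x Ox; rewrite /Q /= eqe mulf_eq0 => fG0.
(* Where [|u x| > 1], neither factor of [Q x] is zero. *)
rewrite ler_norml !leNgt; apply/andP; split; apply/negP => u1; move: fG0.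
- by rewrite (lt_eqF (Glt _ u1)) orbF gt_eqF//; case: (ult u1).
- by rewrite (gt_eqF (Ggt _ u1)) orbF lt_eqF//; case: (ugt u1).
Qed.

End maximum_principle.

(** * Induction over the time steps *)

Theorem theorem3p1 (R : realType) (d : nat) (alpha kappa T : R) (N : nat)
    (Omega : set 'rV[R]_d) (u : nat -> 'rV[R]_d -> R) :
  (1 <= d <= 3)%N ->
  0 < alpha < 1 -> 0 < kappa -> 0 < T -> (0 < N)%N ->
  bounded_smooth_domain Omega ->
  in_L2 Omega (u 0%N) ->
  cs_scheme alpha kappa (T / N%:R) N Omega u ->
  (Lp_norm +oo Omega (u 0%N) <= 1)%E ->
  forall n, (1 <= n <= N)%N -> (Lp_norm +oo Omega (u n) <= 1)%E.
Proof.
move=> _ alpha01 _ T0 N0 [_ oO _ _ _] L0 scheme u0.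
have mu_ n : (n <= N)%N -> measurable_fun Omega (u n).
  case: n => [_|n nN]; first by have /(in_L2P oO)[] := L0.
  by have [g [[[/(in_L2P oO)[mun _] _ _] _] _]] := scheme n.+1 nN.
suff H n : (n <= N)%N -> {ae lebesgue_rV R d, forall x, Omega x -> `|u n x| <= 1}.
  by move=> n /andP[_ nN]; exact/Lp_norm_infty_le1P/H.
(* Strong induction, since the quadrature at each step involves all earlier ones. *)
elim/ltn_ind: n => -[_ _|n IH nN]; first exact/Lp_norm_infty_le1P.
(* The bounds for all earlier steps are gathered outside a single null set; indices beyond [n]
   satisfy the claim vacuously. *)
have IHae : {ae lebesgue_rV R d, forall x, forall j, (j < n.+1)%N ->
    Omega x -> `|u j x| <= 1}.
  apply: ae_foralln => j; have [jn|_] := ltnP j n.+1; last exact: aeW.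
  by apply: filterS (IH j jn (leq_trans (ltnW jn) nN)) => x ux _.
apply: (weak_dirichlet_le1 oO _ _ (scheme n.+1 nN)).
- apply: measurable_funM => //.
  under eq_fun => x do rewrite big_add1/= big_mkord.
  apply: measurable_sum => j; apply: measurable_funM => //.
  apply: measurable_funB; apply: mu_ => //.
  by rewrite (leq_trans (ltn_ord j)).
- apply: measurable_funB; first by apply: mu_; exact: ltnW.
  by apply: measurable_funX; exact: mu_.
- apply: filterS IHae => x ux Ox.
  have ux1 j : (j < n.+1)%N -> `|u j x| <= 1 by move=> jn; exact: ux.
  have := ux1 n (ltnSn n); rewrite ler_norml => /andP[un1 un2].
  have tau0 : 0 <= (T / N%:R) `^ (- alpha) by exact: powR_ge0.
  split=> un; split.
  + by rewrite mulr_ge0//; apply: cq_sum_ge0.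
  (* The cube exceeds [1] while [u n x] does not, so the right-hand side is negative. *)
  + have : 1 < u n.+1 x ^+ 3 by rewrite exprn_egt1.
    by rewrite /=; lra.
  + by rewrite mulr_ge0_le0//; apply: cq_sum_le0.
  (* The mirrored case, reduced to a base above [1] by the odd exponent. *)
  + have : 1 < (- u n.+1 x) ^+ 3 by rewrite exprn_egt1//; lra.
    by rewrite /= exprNn -signr_odd expr1 mulN1r; lra.
Qed.
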